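(* Let $\mathbf{M}\subseteq\Sigma^*$ be a finite language and let $\mathbf{t}$ be an input-decreasing transducer over $\Sigma$ (with respect to a fixed total order $\prec$ on $\Sigma^*$ as in the context). If a language $L\subseteq\mathbf{M}$ is $\mathbf{t}$-independent, then there is $i\in\mathbb{N}$ such that the language $\mu^iL$ is regular, contains $L$, and is maximal $\mathbf{t}$-independent (relative to $\mathbf{M}$).
   Context: $\mathbb{N}$ is the set of positive integers. $\Sigma$ is an alphabet (finite nonempty set) and $\Sigma^*$ is the set of all words over it. Fix a total order $\prec$ (strict) on $\Sigma^*$ such that every word $w$ has a position $\mathrm{pos}(w)\in\{0,1,2,\ldots\}$, the number of words strictly smaller than $w$ (so every word has only finitely many predecessors). A transducer $\mathbf{t}$ over $\Sigma$ is a finite transducer $(Q,\Sigma,T,I,F)$ with finite transition set $T\subseteq Q\times\Sigma^*\times\Sigma^*\times Q$ and sets $I,F\subseteq Q$ of initial and final states; it realizes the relation $R(\mathbf{t})\subseteq\Sigma^*\times\Sigma^*$ of labels of its accepting paths. Write $y\in\mathbf{t}(x)$ iff $(x,y)\in R(\mathbf{t})$, $\mathbf{t}(X)=\bigcup_{x\in X}\mathbf{t}(x)$ for a language $X$, and $\mathbf{t}^{-1}$ for the transducer realizing the inverse relation. $\mathbf{t}$ is input-decreasing if $y\in\mathbf{t}(x)$ implies $y\prec x$, for all words $x,y$. A language $L$ is $\mathbf{t}$-independent if $\mathbf{t}(L)\cap L=\emptyset$. A $\mathbf{t}$-independent $L\subseteq\mathbf{M}$ is maximal $\mathbf{t}$-independent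 (relative to $\mathbf{M}$) if $L\cup\{w\}$ is not $\mathbf{t}$-independent for every $w\in\mathbf{M}\setminus L$. For any language $X$: $\mathrm{I}(X)=\mathbf{M}\setminus(\mathbf{t}(X)\cup\mathbf{t}^{-1}(X))$ and $\mu X=\mathrm{I}(X)\setminus\mathbf{t}^{-1}(\mathrm{I}(X))$. Moreover $\mu^0X=X$ and $\mu^{i+1}X=\mu(\mu^iX)$. *)

(* Defs.v *)
From mathcomp Require Import all_boot finmap.
From mathcomp Require Import boolp classical_sets functions cardinality.

Set Implicit Arguments.
Unset Strict Implicit.
Unset Printing Implicit Defensive.

Local Open Scope classical_set_scope.

Notation language Sigma := (set (seq Sigma)).

(* Strict total orders on words.  Finiteness of the set of predecessors of w,
   i.e. being equipotent to an initial segment `I_n, says exactly that w has a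
   position pos(w) = n. *)
Record word_order (Sigma : finType) (prec : rel (seq Sigma)) : Prop :=
  WordOrder {
    word_order_irr : irreflexive prec;
    word_order_trans : transitive prec;
    word_order_total : forall u v, u != v -> prec u v || prec v u;
    word_order_pos : forall w, finite_set [set v | prec v w]
  }.

Record dfa (Sigma : finType) := Dfa {
  dfa_state : finType;
  dfa_init : dfa_state;
  dfa_final : {set dfa_state};
  dfa_step : dfa_state -> Sigma -> dfa_state
}.

Definition dfa_language (Sigma : finType) (A : dfa Sigma) : language Sigma :=
  [set w | foldl (@dfa_step _ A) (dfa_init A) w \in dfa_final A].

Definition regular (Sigma : finType) (L : language Sigma) : Prop :=
  exists A : dfa Sigma, dfa_language A = L.

Record transducer (Sigma : finType) := Transducer {
  state : finType;
  trans : {fset state * seq Sigma * seq Sigma * state};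
  initial : {set state};
  final : {set state}
}.

(* [tpath t p x y q]: t has a path from p to q with label (x, y). *)
Inductive tpath (Sigma : finType) (t : transducer Sigma) :
    state t -> seq Sigma -> seq Sigma -> state t -> Prop :=
| tpath_nil p : tpath p [::] [::] p
| tpath_cons p u v q x y r :
    (p, u, v, q) \in trans t -> tpath q x y r ->
    tpath p (u ++ x) (v ++ y) r.

Definition realizes (Sigma : finType) (t : transducer Sigma)
    (x y : seq Sigma) : Prop :=
  exists p q, [/\ p \in initial t, q \in final t & tpath p x y q].

Definition word_image (Sigma : finType) (t : transducer Sigma)
    (x : seq Sigma) : language Sigma :=
  [set y | realizes t x y].

Definition transduce (Sigma : finType) (t : transducer Sigma)
    (X : language Sigma) : language Sigma :=
  \bigcup_(x in X) word_image t x.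

Definition inv_transducer (Sigma : finType) (t : transducer Sigma) :
    transducer Sigma :=
  Transducer [fset (e.1.1.1, e.1.2, e.1.1.2, e.2) | e in trans t]%fset
             (initial t) (final t).

Lemma realizes_inv_transducer (Sigma : finType) (t : transducer Sigma)
    (x y : seq Sigma) : realizes (inv_transducer t) x y <-> realizes t y x.
Proof.
split=> -[p [q [ip fq pth]]]; exists p, q; split=> //.
- elim: pth => [r|p' u v q' x' y' r + _ IH]; first exact: tpath_nil.
  by case/imfsetP => -[[[a b] c] d] /= eT [-> -> -> dE];
     apply: tpath_cons IH; rewrite dE.
- elim: pth => [r|p' u v q' x' y' r eT _ IH]; first exact: tpath_nil.
  apply: (@tpath_cons _ (inv_transducer t) _ _ _ q') IH.
  by apply/imfsetP; exists (p', u, v, q').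
Qed.

Definition input_decreasing (Sigma : finType) (prec : rel (seq Sigma))
    (t : transducer Sigma) : Prop :=
  forall x y, word_image t x y -> prec y x.

Definition independent (Sigma : finType) (t : transducer Sigma)
    (L : language Sigma) : Prop :=
  transduce t L `&` L = set0.

Definition maximal_independent (Sigma : finType) (t : transducer Sigma)
    (M L : language Sigma) : Prop :=
  [/\ L `<=` M, independent t L &
      forall w, (M `\` L) w -> ~ independent t (L `|` [set w])].

Definition indep (Sigma : finType) (t : transducer Sigma)
    (M X : language Sigma) : language Sigma :=
  M `\` (transduce t X `|` transduce (inv_transducer t) X).

Definition mu (Sigma : finType) (t : transducer Sigma)
    (M X : language Sigma) : language Sigma :=
  indep t M X `\` transduce (inv_transducer t) (indep t M X).

(* Main.v *)
(** Read [realizes t x y] as an edge from [x] down to [y].  For an independent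
    [X] included in [M], [mu X] consists of the elements of [I(X)] without an
    edge into [I(X)]; it is again independent and contains [X].  As [M] is
    finite, the iteration reaches a fixed point [X = mu X].  There [I(X)] is
    included in [X], by well-founded induction on the word order: an element of
    [I(X)] outside [mu X] has an edge to a smaller element of [I(X)], which lies
    in [X] by induction, contradicting the definition of [I(X)].  This is
    maximality. *)
Require Import Defs.
From mathcomp Require Import all_boot classical_sets functions cardinality.
From mathcomp Require Import finmap boolp.

Local Open Scope classical_set_scope.

(** The number [pos w] of predecessors drops along [prec]: by transitivity the predecessors of [v]
    are among those of [w], and by irreflexivity [v] is one only of [w]. *)
Lemma word_order_wf (Sigma : finType) (prec : rel (seq Sigma)) :
  word_order prec -> well_founded prec.
Proof.
move=> [irr tr _ fin].
pose pos w := #|` fset_set [set v | prec v w]|.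
have pos_lt v w : prec v w -> (pos v < pos w)%N.
  move=> vw; apply: fproper_ltn_card; rewrite fproperEneq; apply/andP; split.
    apply/eqP => eq_vw.
    have : v \in fset_set [set u | prec u w].
      by rewrite in_fset_set //; apply/mem_set.
    by rewrite -eq_vw in_fset_set // => /set_mem /=; rewrite irr.
  apply/fsubsetP => u; rewrite !in_fset_set // => /set_mem uv.
  by apply/mem_set; exact: tr uv vw.
move: pos pos_lt => pos pos_lt w.
have [n] := ubnP (pos w); elim: n w => [|n IH] w; first by rewrite ltn0.
move=> lt_w; constructor=> v /pos_lt lt_v.
by apply: IH; exact: leq_trans lt_v lt_w.
Qed.

(* After reading [w], the automaton is in the state formed by the words [y]
   such that [w ++ y] belongs to the language. *)
Lemma finite_regular (Sigma : finType) (L : language Sigma) :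
  finite_set L -> regular L.
Proof.
move=> /finite_seqP [s ->].
(* Bounding the lengths by [n] makes the sets of words a finite type of states; removing a first
   letter respects the bound. *)
pose n := \max_(w <- s) size w.
pose words (S : {set n.-bseq Sigma}) := [seq val x | x in S].
pose step (S : {set n.-bseq Sigma}) a :=
  [set y : n.-bseq Sigma | a :: y \in words S]%SET.
have wordsE (S : {set n.-bseq Sigma}) (y : n.-bseq Sigma) :
    (val y \in words S) = (y \in S).
  by rewrite mem_map ?mem_enum //; apply: val_inj.
have size_words S w : w \in words S -> size w <= n.
  by case/mapP => x _ ->; apply: size_bseq.
have words_step S a w : (w \in words (step S a)) = (a :: w \in words S).
  apply/idP/idP => [/mapP[x + ->]|aw]; first by rewrite mem_enum inE.
  have le_w : size w <= n by apply: ltnW (size_words _ _ aw).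
  by rewrite (wordsE _ (Bseq le_w)) inE.
have foldl_step S w :
    ([bseq] \in foldl step S w) = (w \in words S).
  elim: w S => [|a w IH] S /=; first by rewrite -wordsE.
  by rewrite IH words_step.
exists (Dfa [set y : n.-bseq Sigma | val y \in s]%SET
            [set S : {set n.-bseq Sigma} | [bseq] \in S]%SET step).
apply/seteqP; split=> w; rewrite /dfa_language /= inE foldl_step.
  by case/mapP => x + ->; rewrite mem_enum inE.
move=> ws; have le_w : size w <= n by apply: leq_bigmax_seq.
by rewrite (wordsE _ (Bseq le_w)) inE.
Qed.

Section Mu.
Variables (Sigma : finType) (t : transducer Sigma) (M : language Sigma).
Implicit Types X : language Sigma.

Lemma independentP X :
  independent t X <-> forall x y, X x -> X y -> ~ realizes t x y.
Proof.
split=> [ind x y Xx Xy xy|ind].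
  suff : (transduce t X `&` X) y by rewrite ind.
  by split=> //; exists x.
by apply/seteqP; split=> // y [[x Xx xy] Xy]; apply: ind xy.
Qed.

Lemma indepP X w : indep t M X w <->
  M w /\ forall x, X x -> ~ realizes t x w /\ ~ realizes t w x.
Proof.
split=> [[Mw nw]|[Mw nw]]; split=> //.
  move=> x Xx; split=> xw; apply: nw; first by left; exists x.
  by right; exists x => //; apply/realizes_inv_transducer.
case=> [] [x Xx xw]; first exact: (nw x Xx).1 xw.
by apply: (nw x Xx).2; apply/realizes_inv_transducer.
Qed.

Lemma muP X w : mu t M X w <->
  indep t M X w /\ forall y, indep t M X y -> ~ realizes t w y.
Proof.
split=> [[Iw nw]|[Iw nw]]; split=> //.
  by move=> y Iy wy; apply: nw; exists y => //; apply/realizes_inv_transducer.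
by case=> y Iy wy; apply: nw Iy _; apply/realizes_inv_transducer.
Qed.

Lemma mu_sub X : mu t M X `<=` M.
Proof. by move=> w [[]]. Qed.

Lemma mu_independent X : independent t (mu t M X).
Proof. by apply/independentP => x y /muP[_ nx] /muP[Iy _]; apply: nx. Qed.

(** Independence puts [X] inside [indep t M X], and no member of the latter is joined by an edge to
    an element of [X]. *)
Lemma sub_mu X : X `<=` M -> independent t X -> X `<=` mu t M X.
Proof.
move=> XM /independentP ind x Xx; apply/muP; split.
  by apply/indepP; split=> [|y Xy]; [exact: XM | split; apply: ind].
by move=> y /indepP[_ /(_ x Xx)[]].
Qed.

Lemma mu_fixpoint_maximal (prec : rel (seq Sigma)) X :
  well_founded prec -> input_decreasing prec t -> mu t M X = X ->
  maximal_independent t M X.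
Proof.
move=> wf decr muX.
have IX w : indep t M X w -> X w.
  elim/(well_founded_ind wf): w => w IH Iw; apply: contrapT => nXw.
  apply: nXw; rewrite -muX; apply/muP; split=> // y Iy wy.
  have Xy : X y by apply: IH => //; apply: decr.
  by case/indepP: Iw => _ /(_ y Xy)[].
split; [by rewrite -muX; apply: mu_sub | |].
  by rewrite -muX; apply: mu_independent.
(* If adding [w] kept independence, no edge would join [w] to [X] in either direction, so [w] would
   lie in [indep t M X], hence in [X]. *)
move=> w [Mw nXw] /independentP ind; apply: nXw; apply: IX; apply/indepP.
by split=> // x Xx; split; apply: ind; by [left | right].
Qed.

(** Induction on the number of elements of [M] outside [X], which drops at each application of [mu]
    until a fixed point is reached. *)
Lemma iter_mu_fixpoint X : finite_set M -> X `<=` M -> independent t X ->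
  exists i, let Y := iter i (mu t M) X in X `<=` Y /\ mu t M Y = Y.
Proof.
move=> Mfin; have [n] := ubnP #|` fset_set (M `\` X)|.
elim: n X => [|n IH] X; first by rewrite ltn0.
move=> lt_n XM indX.
have [muX|muX] := pselect (mu t M X = X); first by exists 0; split.
have sX := sub_mu X XM indX.
have finD Y : finite_set (M `\` Y) by apply: finite_setD.
have [|i [si fi]] := IH (mu t M X) _ (mu_sub X) (mu_independent X).
  apply: leq_trans (fproper_ltn_card _) lt_n.
  rewrite fproperEneq; apply/andP; split.
    (* Both sets lie in [M], so equal complements in [M] would force [mu t M X = X]. *)
    apply/eqP => eqD; apply: muX; apply/seteqP; split=> // x muXx.
    apply: contrapT => nXx.
    have : x \in fset_set (M `\` X).
      by rewrite in_fset_set //; apply/mem_set; split=> //; apply: mu_sub muXx.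
    by rewrite -eqD in_fset_set // => /set_mem[].
  apply/fsubsetP => x; rewrite !in_fset_set // => /set_mem[Mx nx].
  by apply/mem_set; split=> // /sX.
by exists i.+1; rewrite iterSr; split=> //; apply: subset_trans si.
Qed.

End Mu.

Theorem theorem21 (Sigma : finType) (Sigma_nonempty : (0 < #|Sigma|)%N)
    (prec : rel (seq Sigma)) (prec_order : word_order prec)
    (M : language Sigma) (M_finite : finite_set M)
    (t : transducer Sigma) (t_decr : input_decreasing prec t)
    (L : language Sigma) (L_sub : L `<=` M) (L_indep : independent t L) :
  exists i : nat, (0 < i)%N /\
    [/\ regular (iter i (mu t M) L),
        L `<=` iter i (mu t M) L &
        maximal_independent t M (iter i (mu t M) L)].
Proof.
have [i [sub fix_i]] := iter_mu_fixpoint _ t _ _ M_finite L_sub L_indep.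
(* Here [i] may be 0; one further step yields a positive exponent and the same language, which is
   regular because it is a subset of the finite [M]. *)
exists i.+1; split=> //; rewrite iterS fix_i; split=> //.
  apply/finite_regular/(sub_finite_set _ M_finite).
  by rewrite -fix_i; apply: mu_sub.
exact: mu_fixpoint_maximal _ _ _ _ _ (word_order_wf _ _ prec_order) t_decr fix_i.
Qed.
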